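(* Let $ABC$ be a nondegenerate, non-equilateral triangle with semiperimeter $s$, inradius $r$, circumradius $R$, circumcenter $O$, orthocenter $H$ and Mittenpunkt $M$. Then $$\frac{R(4R+r)^2}{2(2R-r)}-s^2\ \ge\ \frac{(4R+r)^2}{2R(2R-r)}\cdot\frac{4S^2\,[O;H;M]^2}{|OH|^2}\ =\ \frac{(2R+r)^2\,d_I}{2R(2R-r)} .$$
   Context: $S$ is the area of $ABC$. With $a=|BC|$, $b=|CA|$, $c=|AB|$, the Mittenpunkt $M$ (the point $X(9)$ in the Encyclopedia of Triangle Centers) has homogeneous barycentric coordinates $a(s-a):b(s-b):c(s-c)$. Points are represented by their barycentric coordinate row vectors with respect to $ABC$, normalized to have coordinate sum $1$, and $[X;Y;Z]$ is the determinant of the $3\times3$ matrix whose rows are the coordinate vectors of $X,Y,Z$. $d_I$ is the squared distance from the incenter $I$ to the Euler line $OH$, i.e. the minimum over $\lambda\in\mathbb{R}$ of $|XI|^2$ with $X=(1-\lambda)H+\lambda O$. *)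

(* Defs.v *)
From HB Require Import structures.
From mathcomp Require Import all_boot all_order all_algebra.
From mathcomp Require Import reals.

Set Implicit Arguments.
Unset Strict Implicit.
Unset Printing Implicit Defensive.

Import Order.TTheory GRing.Theory Num.Theory.
Local Open Scope ring_scope.

Definition dot (K : realType) (u v : 'rV[K]_2) : K :=
  \sum_(i < 2) u 0 i * v 0 i.

Definition sqdist (K : realType) (X Y : 'rV[K]_2) : K := dot (X - Y) (X - Y).

Definition dist (K : realType) (X Y : 'rV[K]_2) : K := Num.sqrt (sqdist X Y).

Definition rows3 (K : realType) (n : nat) (X Y Z : 'rV[K]_n) : 'M[K]_(3, n) :=
  \matrix_(i < 3) [:: X; Y; Z]`_i.

Definition nondegenerate_triangle (K : realType) (A B C : 'rV[K]_2) : Prop :=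
  row_free (col_mx (B - A) (C - A)).

Definition equilateral_triangle (K : realType) (A B C : 'rV[K]_2) : Prop :=
  dist B C = dist C A /\ dist C A = dist A B.

Definition area (K : realType) (A B C : 'rV[K]_2) : K :=
  `|\det (col_mx (B - A) (C - A) : 'M[K]_2)| / 2.

Definition semiperimeter (K : realType) (A B C : 'rV[K]_2) : K :=
  (dist B C + dist C A + dist A B) / 2.

(* Normalized barycentric coordinates of X: see [baryP] below. *)
Definition bary (K : realType) (A B C X : 'rV[K]_2) : 'rV[K]_3 :=
  row_mx X (const_mx 1 : 'M[K]_1) *m
  invmx (row_mx (rows3 A B C) (const_mx 1 : 'cV[K]_3) : 'M[K]_3).

Lemma mul_rows3 (K : realType) (n : nat) (X Y Z : 'rV[K]_n) (u : 'rV[K]_3) :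
  u *m rows3 X Y Z = u 0 0 *: X + u 0 1 *: Y + u 0 2 *: Z.
Proof.
rewrite mulmx_sum_row !big_ord_recl big_ord0 addr0 !rowK addrA /=.
by congr (u 0 _ *: _ + u 0 _ *: _ + u 0 _ *: _); apply: val_inj.
Qed.

Lemma mul_row3_1 (K : realType) (u : 'rV[K]_3) :
  u *m (const_mx 1 : 'cV_3) = const_mx (\sum_i u 0 i).
Proof.
by apply/rowP => i; rewrite !mxE; apply: eq_bigr => j _; rewrite mxE mulr1.
Qed.

Lemma lift_unit (K : realType) (A B C : 'rV[K]_2) : nondegenerate_triangle A B C ->
  (row_mx (rows3 A B C) (const_mx 1 : 'cV[K]_3) : 'M[K]_3) \in unitmx.
Proof.
move=> nd; rewrite -row_free_unit -kermx_eq0 -submx0; apply/rV_subP => u.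
move=> /sub_kermxP uT0.
have : u *m row_mx (rows3 A B C) (const_mx 1 : 'cV[K]_3) = row_mx 0 0.
  by rewrite row_mx0; apply: uT0.
rewrite mul_mx_row => /eq_row_mx[]; rewrite mul_rows3 mul_row3_1 => uABC /rowP/(_ 0).
rewrite !mxE !big_ord_recl big_ord0 addr0.
rewrite (_ : lift ord0 (lift ord0 ord0) = 2); last exact: val_inj.
rewrite (_ : lift ord0 ord0 = 1); last exact: val_inj.
move/eqP; rewrite addr_eq0 => /eqP u0.
pose v : 'rV[K]_(1 + 1) := row_mx (u 0 1)%:M (u 0 2)%:M.
have /(row_free_inj nd) : v *m col_mx (B - A) (C - A) = 0 *m col_mx (B - A) (C - A).
  rewrite mul0mx mul_row_col !mul_scalar_mx -uABC u0.
  by rewrite scaleNr scalerDl !scalerBr opprD addrACA [LHS]addrC addrA.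
rewrite -[X in _ = X](@row_mx0 K 1 1 1) => /eq_row_mx[].
move=> /rowP/(_ 0); rewrite !mxE eqxx mulr1n => u1.
move=> /rowP/(_ 0); rewrite !mxE eqxx mulr1n => u2.
rewrite submx0; apply/eqP/rowP => k; rewrite mxE.
case: k => -[|[|[|//]]] lt_k3.
- by rewrite (_ : Ordinal _ = 0) ?u0 ?u1 ?u2 ?addr0 ?oppr0 //; apply: val_inj.
- by rewrite (_ : Ordinal _ = 1) ?u1 //; apply: val_inj.
- by rewrite (_ : Ordinal _ = 2) ?u2 //; apply: val_inj.
Qed.

Lemma baryP (K : realType) (A B C X : 'rV[K]_2) (u : 'rV[K]_3) :
  nondegenerate_triangle A B C ->
  u = bary A B C X <->
  \sum_i u 0 i = 1 /\ u 0 0 *: A + u 0 1 *: B + u 0 2 *: C = X.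
Proof.
move=> /lift_unit unitT; split=> [uE | [u1 uX]].
  have : u *m row_mx (rows3 A B C) (const_mx 1 : 'cV[K]_3) =
         row_mx X (const_mx 1).
    by rewrite uE; apply: (@mulmxKV _ 3 1 _ unitT).
  rewrite mul_mx_row => /eq_row_mx[]; rewrite mul_rows3 mul_row3_1 => -> u1.
  by split=> //; move/rowP/(_ 0): u1; rewrite !mxE.
have uT : row_mx X (const_mx 1 : 'M_1) =
          u *m row_mx (rows3 A B C) (const_mx 1 : 'cV[K]_3).
  by rewrite mul_mx_row mul_rows3 mul_row3_1 u1 uX.
by rewrite /bary uT; apply/esym; apply: (@mulmxK _ 3 1 _ unitT).
Qed.

Definition point_of_bary (K : realType) (A B C : 'rV[K]_2) (x y z : K) :
    'rV[K]_2 :=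
  (x + y + z)^-1 *: (x *: A + y *: B + z *: C).

Definition mittenpunkt (K : realType) (A B C : 'rV[K]_2) : 'rV[K]_2 :=
  let a := dist B C in let b := dist C A in let c := dist A B in
  let s := semiperimeter A B C in
  point_of_bary A B C (a * (s - a)) (b * (s - b)) (c * (s - c)).

Definition bary_det (K : realType) (A B C X Y Z : 'rV[K]_2) : K :=
  \det (rows3 (bary A B C X) (bary A B C Y) (bary A B C Z)).

(* d is the minimum over l of |PX|^2 with X = (1 - l) U + l V. *)
Definition is_sqdist_to_line (K : realType) (P U V : 'rV[K]_2) (d : K) : Prop :=
  (exists l : K, d = sqdist P ((1 - l) *: U + l *: V)) /\
  (forall l : K, d <= sqdist P ((1 - l) *: U + l *: V)).

Definition is_circumcircle (K : realType) (A B C O : 'rV[K]_2) (R : K) : Prop :=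
  [/\ dist O A = R, dist O B = R & dist O C = R].

Definition is_orthocenter (K : realType) (A B C H : 'rV[K]_2) : Prop :=
  [/\ dot (H - A) (B - C) = 0, dot (H - B) (C - A) = 0
    & dot (H - C) (A - B) = 0].

(* The circle with center I and radius r is tangent to the three side lines;
   positivity of the barycentric coordinates puts I inside the triangle,
   which excludes the excircles. *)
Definition is_incircle (K : realType) (A B C I : 'rV[K]_2) (r : K) : Prop :=
  [/\ 0 < r, forall i, 0 < bary A B C I 0 i,
      is_sqdist_to_line I B C (r ^+ 2), is_sqdist_to_line I C A (r ^+ 2)
    & is_sqdist_to_line I A B (r ^+ 2)].

(* Main.v *)
Require Import Defs.
From HB Require Import structures.
From mathcomp Require Import all_boot all_order all_algebra.
From mathcomp Require Import reals.
From mathcomp Require Import ring lra.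

Set Implicit Arguments.
Unset Strict Implicit.
Unset Printing Implicit Defensive.

Import Order.TTheory GRing.Theory Num.Theory.
Local Open Scope ring_scope.

(* Take O as origin and put h = OH = OA + OB + OC, i = OI. Since
   (4R + r) OM = 2R h - (2R + r) i, the cross products of h with OM and with i
   are proportional, and they are the doubled areas behind [O;H;M] and d_I; this
   is the equality. For the inequality, |h|^2, |i|^2 and <h, i> are polynomials
   in R, r and s^2, hence so is |h|^2 d_I = |h|^2 |i|^2 - <h, i>^2, and the gap
   multiplied by 2R (2R - r) |h|^2 is a perfect square. *)

(** * Dot and cross products in the plane *)

Definition cross (K : realType) (u v : 'rV[K]_2) : K :=
  u 0 0 * v 0 1 - u 0 1 * v 0 0.

Lemma dotE (K : realType) (u v : 'rV[K]_2) :
  dot u v = u 0 0 * v 0 0 + u 0 1 * v 0 1.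
Proof.
rewrite /dot !big_ord_recl big_ord0 addr0.
by rewrite (_ : lift ord0 ord0 = 1) //; apply: val_inj.
Qed.

Lemma dotC (K : realType) (u v : 'rV[K]_2) : dot u v = dot v u.
Proof. by rewrite !dotE; ring. Qed.

Lemma dotDl (K : realType) (u v w : 'rV[K]_2) :
  dot (u + v) w = dot u w + dot v w.
Proof. by rewrite !dotE !mxE; ring. Qed.

Lemma dotDr (K : realType) (u v w : 'rV[K]_2) :
  dot u (v + w) = dot u v + dot u w.
Proof. by rewrite !dotE !mxE; ring. Qed.

Lemma dotZl (K : realType) (k : K) (u v : 'rV[K]_2) :
  dot (k *: u) v = k * dot u v.
Proof. by rewrite !dotE !mxE; ring. Qed.

Lemma dotZr (K : realType) (k : K) (u v : 'rV[K]_2) :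
  dot u (k *: v) = k * dot u v.
Proof. by rewrite !dotE !mxE; ring. Qed.

Lemma dotvv_ge0 (K : realType) (u : 'rV[K]_2) : 0 <= dot u u.
Proof. by rewrite dotE -!expr2 addr_ge0 ?sqr_ge0. Qed.

Lemma dotvv_eq0 (K : realType) (u : 'rV[K]_2) : (dot u u == 0) = (u == 0).
Proof.
apply/idP/eqP => [|->]; last by rewrite dotE !mxE !mul0r addr0.
rewrite dotE -!expr2 paddr_eq0 ?sqr_ge0 // !sqrf_eq0 => /andP[/eqP u0 /eqP u1].
apply/rowP => -[[|[|//]] lt_k]; rewrite mxE.
  by rewrite (_ : Ordinal _ = 0) //; apply: val_inj.
by rewrite (_ : Ordinal _ = 1) //; apply: val_inj.
Qed.

Lemma crossDr (K : realType) (u v w : 'rV[K]_2) :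
  cross u (v + w) = cross u v + cross u w.
Proof. by rewrite /cross !mxE; ring. Qed.

Lemma crossZr (K : realType) (k : K) (u v : 'rV[K]_2) :
  cross u (k *: v) = k * cross u v.
Proof. by rewrite /cross !mxE; ring. Qed.

Lemma cross_sqr (K : realType) (u v : 'rV[K]_2) :
  cross u v ^+ 2 = dot u u * dot v v - dot u v ^+ 2.
Proof. by rewrite /cross !dotE; ring. Qed.

Lemma dot_cross_eq0 (K : realType) (u v w : 'rV[K]_2) :
  cross v w != 0 -> dot u v = 0 -> dot u w = 0 -> u = 0.
Proof.
move=> vw uv uw; apply/eqP; rewrite -dotvv_eq0 -(mulrI_eq0 _ (mulfI vw)).
have -> : cross v w * dot u u =
    dot u v * cross u w - dot u w * cross u v.
  by rewrite /cross !dotE; ring.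
by rewrite uv uw !mul0r subr0.
Qed.

(* Exposing the indices as naturals lets them compute in cofactor expansions. *)
Lemma mx_natE (K : realType) (m n : nat) (M : 'M[K]_(m.+1, n.+1)) :
  exists f : nat -> nat -> K, forall i j, M i j = f i j.
Proof.
by exists (fun i j => M (inord i) (inord j)) => i j; rewrite !inord_val.
Qed.

(** * Explicit determinants of orders two and three *)

Lemma det_mx2 (K : realType) (M : 'M[K]_2) :
  \det M = M 0 0 * M 1 1 - M 0 1 * M 1 0.
Proof.
rewrite (expand_det_row _ 0) !big_ord_recl big_ord0 addr0 /cofactor !det_mx11.
rewrite !mxE; have [f ME] := mx_natE M.
by rewrite !ME /= /bump /= expr0 expr1; ring.
Qed.

Lemma det_col_mx2 (K : realType) (u v : 'rV[K]_2) :
  \det (col_mx u v : 'M[K]_2) = cross u v.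
Proof.
have u_row j : (col_mx u v : 'M[K]_2) 0 j = u 0 j.
  rewrite -[RHS](col_mxEu u v 0 j); congr (col_mx u v _ j); exact: val_inj.
have v_row j : (col_mx u v : 'M[K]_2) 1 j = v 0 j.
  rewrite -[RHS](col_mxEd u v 0 j); congr (col_mx u v _ j); exact: val_inj.
by rewrite det_mx2 !u_row !v_row.
Qed.

Lemma det_rows3 (K : realType) (u v w : 'rV[K]_3) :
  \det (rows3 u v w) =
    u 0 0 * (v 0 1 * w 0 2 - v 0 2 * w 0 1)
    - u 0 1 * (v 0 0 * w 0 2 - v 0 2 * w 0 0)
    + u 0 2 * (v 0 0 * w 0 1 - v 0 1 * w 0 0).
Proof.
rewrite (expand_det_row _ 0) !big_ord_recl big_ord0 addr0 /cofactor !det_mx2.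
have [fu uE] := mx_natE u; have [fv vE] := mx_natE v.
have [fw wE] := mx_natE w.
rewrite !mxE /= /bump /= !uE !vE !wE /= /bump /= expr0 expr1 sqrrN expr1n.
ring.
Qed.

(** * Distances to lines and areas in barycentric coordinates *)

(** Completing the square in [l] splits the squared distance times |UV|^2 into a constant squared
    cross product and a square that can be made zero. *)
Lemma sqdist_to_lineE (K : realType) (P U V : 'rV[K]_2) (d : K) :
  is_sqdist_to_line P U V d ->
  d * dot (V - U) (V - U) = cross (V - U) (P - U) ^+ 2.
Proof.
set e := V - U; set g := P - U => -[[l0 dE] d_min].
have distE l : sqdist P ((1 - l) *: U + l *: V) * dot e e =
    cross e g ^+ 2 + (l * dot e e - dot e g) ^+ 2.
  rewrite /sqdist (_ : P - _ = g + (- l) *: e); last first.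
    by apply/rowP => j; rewrite !mxE; ring.
  rewrite cross_sqr; move: e g => e g.
  by rewrite !(dotDl, dotDr, dotZl, dotZr) (dotC g e); ring.
have [e0|e_neq0] := eqVneq (dot e e) 0.
  move/eqP: (e0); rewrite dotvv_eq0 => /eqP ->.
  by rewrite /cross dotE !mxE; ring.
apply/le_anti/andP; split; last by rewrite dE distE lerDl sqr_ge0.
(* This parameter is the foot of the perpendicular from [P], where the square depending on [l]
   vanishes. *)
have := d_min (dot e g / dot e e).
rewrite -(ler_pM2r (_ : 0 < dot e e)) ?lt0r ?e_neq0 ?dotvv_ge0 // distE.
by rewrite divfK // subrr expr0n addr0.
Qed.

Lemma cross_neq0 (K : realType) (A B C : 'rV[K]_2) :
  nondegenerate_triangle A B C -> cross (B - A) (C - A) != 0.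
Proof.
rewrite /nondegenerate_triangle -det_col_mx2 -unitfE => nd.
by rewrite -unitmxE -row_free_unit.
Qed.

Lemma areaE (K : realType) (A B C : 'rV[K]_2) :
  area A B C = `|cross (B - A) (C - A)| / 2.
Proof. by rewrite /area det_col_mx2. Qed.

(** The barycentric determinant is the ratio of the signed areas of XYZ and ABC; this is what
    removes S from the term 4 S^2 [O;H;M]^2. *)
Lemma bary_detE (K : realType) (A B C X Y Z : 'rV[K]_2) :
  nondegenerate_triangle A B C ->
  cross (B - A) (C - A) * bary_det A B C X Y Z = cross (Y - X) (Z - X).
Proof.
move=> nd.
have bP T : let u := bary A B C T in
    u 0 0 = 1 - u 0 1 - u 0 2 /\ T = u 0 0 *: A + u 0 1 *: B + u 0 2 *: C.
  move=> u; have [u1 ->] := (baryP T u nd).1 erefl; split=> //.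
  move: u1; have [f uE] := mx_natE u.
  by rewrite !big_ord_recl big_ord0 !uE /= /bump /= => <-; ring.
rewrite /bary_det det_rows3.
have [X0 XE] := bP X; have [Y0 YE] := bP Y; have [Z0 ZE] := bP Z.
move: X0 XE Y0 YE Z0 ZE.
move: (bary A B C X) (bary A B C Y) (bary A B C Z) => x y z.
move=> x0 -> y0 -> z0 ->.
by rewrite x0 y0 z0 /cross !mxE; ring.
Qed.

(** * Side lengths, circumcircle and orthocenter *)

Lemma sqr_distE (K : realType) (X Y : 'rV[K]_2) :
  dist X Y ^+ 2 = dot (X - Y) (X - Y).
Proof. by rewrite sqr_sqrtr ?dotvv_ge0. Qed.

Lemma heron (K : realType) (A B C : 'rV[K]_2) :
  let a := dist B C in let b := dist C A in let c := dist A B in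
  4 * cross (B - A) (C - A) ^+ 2 =
    (a + b + c) * (b + c - a) * (c + a - b) * (a + b - c).
Proof.
move=> a b c.
(* In this form only squared lengths occur, and they are dot products. *)
have -> : (a + b + c) * (b + c - a) * (c + a - b) * (a + b - c) =
    4 * c ^+ 2 * b ^+ 2 - (b ^+ 2 + c ^+ 2 - a ^+ 2) ^+ 2 by ring.
by rewrite !sqr_distE /cross !dotE !mxE; ring.
Qed.

Lemma circumcircle_dot (K : realType) (A B C O : 'rV[K]_2) (R : K) :
  is_circumcircle A B C O R ->
  [/\ dot (A - O) (A - O) = R ^+ 2, dot (B - O) (B - O) = R ^+ 2,
      dot (C - O) (C - O) = R ^+ 2 &
  [/\ dot (B - O) (C - O) = R ^+ 2 - dist B C ^+ 2 / 2,
      dot (C - O) (A - O) = R ^+ 2 - dist C A ^+ 2 / 2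
    & dot (A - O) (B - O) = R ^+ 2 - dist A B ^+ 2 / 2]].
Proof.
case=> /(congr1 (fun x => x ^+ 2)) + /(congr1 (fun x => x ^+ 2)) + 
  /(congr1 (fun x => x ^+ 2)).
rewrite !sqr_distE !dotE !mxE => pR qR wR.
by split; [lra|lra|lra|split; lra].
Qed.

(** This is abc = 4RS, squared. The Gram determinant of OA, OB, OC vanishes because three plane
    vectors are dependent; its entries are known from R and the sides. *)
Lemma circumradius_sqr (K : realType) (A B C O : 'rV[K]_2) (R : K) :
  is_circumcircle A B C O R ->
  4 * R ^+ 2 * cross (B - A) (C - A) ^+ 2 =
    (dist B C * dist C A * dist A B) ^+ 2.
Proof.
move=> /circumcircle_dot[].
set p := A - O; set q := B - O; set w := C - O => pp qq ww [qw wp pq].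
have gram0 : dot p p * (dot q q * dot w w - dot q w ^+ 2)
    - dot p q * (dot p q * dot w w - dot q w * dot w p)
    + dot w p * (dot p q * dot q w - dot q q * dot w p) = 0.
  by rewrite !dotE; ring.
rewrite mulrAC heron; move: gram0; rewrite pp qq ww qw wp pq => gram0.
by lra.
Qed.

(** Since |OA| = |OB|, the vector OA + OB is orthogonal to AB, as is CH. So the difference of the
    two sides is orthogonal to AB, likewise to AC, and vanishes. *)
Lemma orthocenterE (K : realType) (A B C O H : 'rV[K]_2) (R : K) :
  nondegenerate_triangle A B C -> is_circumcircle A B C O R ->
  is_orthocenter A B C H ->
  H - O = (A - O) + (B - O) + (C - O).
Proof.
move=> /cross_neq0 D0 /circumcircle_dot[pp qq ww _] [hA hB hC].
apply/eqP; rewrite -subr_eq0; apply/eqP.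
move: pp qq ww hA hB hC; rewrite !dotE !mxE => pp qq ww hA hB hC.
apply: (dot_cross_eq0 D0); rewrite dotE !mxE; lra.
Qed.

(** Pairing the zero sum with OA, OB, OC shows that any two squared sides add up to 6R^2. This will
    give OH != 0. *)
Lemma equilateral_of_circumcenter (K : realType) (A B C O : 'rV[K]_2) (R : K) :
  is_circumcircle A B C O R -> (A - O) + (B - O) + (C - O) = 0 ->
  equilateral_triangle A B C.
Proof.
move=> /circumcircle_dot[pp qq ww [qw wp pq]] h0.
have hE T : dot (A - O) T + dot (B - O) T + dot (C - O) T = 0.
  by rewrite -!dotDl h0 dotE !mxE; ring.
have := hE (A - O); have := hE (B - O); have := hE (C - O).
rewrite (dotC (B - O) (A - O)) (dotC (C - O) (B - O)) (dotC (A - O) (C - O)).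
rewrite pp qq ww qw wp pq => hC hB hA.
by split; apply/eqP; rewrite -(@eqrXn2 _ 2) ?sqrtr_ge0 //; apply/eqP; lra.
Qed.

(** * Incircle and symmetric functions of the sides *)

Lemma dist_gt0 (K : realType) (X Y : 'rV[K]_2) : X - Y != 0 -> 0 < dist X Y.
Proof. by move=> XY; rewrite sqrtr_gt0 lt0r dotvv_eq0 XY dotvv_ge0. Qed.

Lemma sides_gt0 (K : realType) (A B C : 'rV[K]_2) :
  nondegenerate_triangle A B C ->
  [/\ 0 < dist B C, 0 < dist C A & 0 < dist A B].
Proof.
move=> /cross_neq0 D0.
split; apply: dist_gt0; apply: contraNneq D0 => /eqP;
  rewrite subr_eq0 => /eqP ->; rewrite /cross !mxE; apply/eqP; ring.
Qed.

(** Each tangency equates, up to sign, two expressions for a doubled area such as that of IBC: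
    [r * a] and [u 0 0 * D]. Positive coordinates settle the sign, and summing gives the doubled
    area of ABC. *)
Lemma incircleE (K : realType) (A B C I : 'rV[K]_2) (r : K) :
  nondegenerate_triangle A B C -> is_incircle A B C I r ->
  let a := dist B C in let b := dist C A in let c := dist A B in
  r * (a + b + c) = `|cross (B - A) (C - A)| /\
  (a + b + c) *: I = a *: A + b *: B + c *: C.
Proof.
move=> nd [r_gt0 u_gt0 tA tB tC] a b c.
have [a_gt0 b_gt0 c_gt0] := sides_gt0 nd.
have [u1 uI] := (baryP I _ nd).1 erefl; move: u1 uI u_gt0.
move: (bary A B C I) => u; set D := cross _ _ => u1 uI u_gt0.
have u0 : u 0 0 = 1 - u 0 1 - u 0 2.
  move: u1; have [f uE] := mx_natE u.
  by rewrite !big_ord_recl big_ord0 !uE /= /bump /= => <-; ring.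
have tangent (x y d : K) : 0 < y -> 0 < d -> r ^+ 2 * d ^+ 2 = (y * x) ^+ 2 ->
    r * d = y * `|x|.
  move=> y_gt0 d_gt0 e; apply/eqP; rewrite -(@eqrXn2 _ 2) ?mulr_ge0 ?normr_ge0 ?(ltW y_gt0) ?(ltW d_gt0) ?(ltW r_gt0) //.
  by rewrite !exprMn real_normK ?num_real // e exprMn.
have ra : r * a = u 0 0 * `|D|.
  apply: tangent => //; rewrite /a sqr_distE.
  have := sqdist_to_lineE tA; rewrite -uI u0 /D /cross !dotE !mxE => e.
  by lra.
have rb : r * b = u 0 1 * `|D|.
  apply: tangent => //; rewrite /b sqr_distE.
  have := sqdist_to_lineE tB; rewrite -uI u0 /D /cross !dotE !mxE => e.
  by lra.
have rc : r * c = u 0 2 * `|D|.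
  apply: tangent => //; rewrite /c sqr_distE.
  have := sqdist_to_lineE tC; rewrite -uI u0 /D /cross !dotE !mxE => e.
  by lra.
have rabc : r * (a + b + c) = `|D| by rewrite !mulrDr ra rb rc u0; ring.
split=> //; apply: (@scalerI _ _ r); first by rewrite gt_eqF.
rewrite scalerA rabc !scalerDr !scalerA ra rb rc -uI !scalerDr !scalerA.
by rewrite ![_ * `|D|]mulrC.
Qed.

(* The second equation is ab + bc + ca = s^2 + r^2 + 4Rr. *)
Lemma side_symmetric_functions (K : realType) (A B C O I : 'rV[K]_2) (R r : K) :
  nondegenerate_triangle A B C -> is_circumcircle A B C O R ->
  is_incircle A B C I r ->
  let a := dist B C in let b := dist C A in let c := dist A B in
  a * b * c = 2 * R * r * (a + b + c) /\
  4 * (a * b + b * c + c * a) = (a + b + c) ^+ 2 + 4 * r ^+ 2 + 16 * R * r.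
Proof.
move=> nd cO inI a b c.
have [a_gt0 b_gt0 c_gt0] := sides_gt0 nd.
have R_ge0 : 0 <= R by have [<- _ _] := cO; apply: sqrtr_ge0.
have r_gt0 : 0 < r by have [] := inI.
have [rD _] := incircleE nd inI; rewrite /= -/a -/b -/c in rD.
have x_gt0 : 0 < a + b + c by rewrite !addr_gt0.
have D2 : cross (B - A) (C - A) ^+ 2 = r ^+ 2 * (a + b + c) ^+ 2.
  by rewrite -exprMn rD real_normK ?num_real.
have abc : a * b * c = 2 * R * r * (a + b + c).
  apply/eqP; rewrite -(@eqrXn2 _ 2) //.
  - by rewrite -(circumradius_sqr cO) D2; apply/eqP; ring.
  - by rewrite !mulr_ge0 ?ltW.
  - by rewrite !mulr_ge0 // ltW.
split=> //; have := heron A B C; rewrite /= -/a -/b -/c D2 => hr.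
(* Heron's formula with S = rs, divided by a + b + c. Expanding the product leaves ab + bc + ca
   times a + b + c, and a multiple of abc. *)
have hr' : 4 * (r ^+ 2 * (a + b + c)) =
    (b + c - a) * (c + a - b) * (a + b - c).
  by apply: (mulfI (lt0r_neq0 x_gt0)); rewrite !mulrA -hr; ring.
apply: (mulfI (lt0r_neq0 x_gt0)).
by lra.
Qed.

(** * Circumcenter and Mittenpunkt *)

(** The dot product of the combination with each of OA, OB, OC is 16 S^2 R^2 - a^2 b^2 c^2 = 0, so
    the combination is orthogonal to itself. *)
Lemma circumcenter_bary (K : realType) (A B C O : 'rV[K]_2) (R : K) :
  is_circumcircle A B C O R ->
  let a2 := dist B C ^+ 2 in let b2 := dist C A ^+ 2 in
  let c2 := dist A B ^+ 2 in
  (a2 * (b2 + c2 - a2)) *: (A - O) + (b2 * (c2 + a2 - b2)) *: (B - O)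
    + (c2 * (a2 + b2 - c2)) *: (C - O) = 0.
Proof.
move=> cO a2 b2 c2.
have := circumradius_sqr cO; rewrite !exprMn -/a2 -/b2 -/c2 [4 * _ * _]mulrAC heron.
rewrite (_ : _ * _ * _ * _ = 4 * c2 * b2 - (b2 + c2 - a2) ^+ 2); last first.
  by rewrite /a2 /b2 /c2; ring.
have [] := circumcircle_dot cO; rewrite -/a2 -/b2 -/c2.
move: (A - O) (B - O) (C - O) a2 b2 c2 => p q w a2 b2 c2.
move=> pp qq ww [qw wp pq] SR.
set n := (X in X = 0); apply/eqP; rewrite -dotvv_eq0; apply/eqP.
have np : dot n p = 0.
  rewrite /n !(dotDl, dotZl) (dotC q p) pp pq wp; lra.
have nq : dot n q = 0.
  rewrite /n !(dotDl, dotZl) (dotC w q) qq pq qw; lra.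
have nw : dot n w = 0.
  rewrite /n !(dotDl, dotZl) (dotC p w) ww wp qw; lra.
by rewrite {2}/n !(dotDr, dotZr) np nq nw; ring.
Qed.

(* With the circumcenter as origin, (4R + r) M = 2R H - (2R + r) I. *)
Lemma cross_mittenpunkt (K : realType) (A B C O I : 'rV[K]_2) (R r : K) :
  nondegenerate_triangle A B C -> is_circumcircle A B C O R ->
  is_incircle A B C I r ->
  let h := (A - O) + (B - O) + (C - O) in
  (4 * R + r) * cross h (mittenpunkt A B C - O) =
    - ((2 * R + r) * cross h (I - O)).
Proof.
move=> nd cO inI h.
have [a_gt0 b_gt0 c_gt0] := sides_gt0 nd.
have R_ge0 : 0 <= R by have [<- _ _] := cO; apply: sqrtr_ge0.
have r_gt0 : 0 < r by have [] := inI.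
have [abc e2] := side_symmetric_functions nd cO inI.
have [_ IE] := incircleE nd inI.
have := circumcenter_bary cO.
rewrite /mittenpunkt /semiperimeter /=.
move: (dist B C) (dist C A) (dist A B) a_gt0 b_gt0 c_gt0 abc e2 IE.
move=> a b c a_gt0 b_gt0 c_gt0 abc e2 IE.
move=> circ0.
have circ : a ^+ 2 * (b ^+ 2 + c ^+ 2 - a ^+ 2) * cross h (A - O)
    + b ^+ 2 * (c ^+ 2 + a ^+ 2 - b ^+ 2) * cross h (B - O)
    + c ^+ 2 * (a ^+ 2 + b ^+ 2 - c ^+ 2) * cross h (C - O) = 0.
  by rewrite -!crossZr -!crossDr circ0 /cross !mxE; ring.
have hh : cross h (A - O) + cross h (B - O) + cross h (C - O) = 0.
  by rewrite /h /cross !mxE; ring.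
have x_gt0 : 0 < a + b + c by rewrite !addr_gt0.
have hI : (a + b + c) * cross h (I - O) =
    a * cross h (A - O) + b * cross h (B - O) + c * cross h (C - O).
  rewrite -!crossZr -!crossDr; congr cross.
  by rewrite scalerBr IE; apply/rowP => j; rewrite !mxE; ring.
set s := (a + b + c) / 2.
pose t := a * (s - a) + b * (s - b) + c * (s - c).
(* Here t = 2(ab + bc + ca) - 2s^2, which is where the factor 4R + r comes from. *)
have tE : t = 2 * r * (4 * R + r).
  by rewrite /t /s; lra.
have t_neq0 : t != 0.
  by rewrite tE mulf_neq0 ?gt_eqF ?mulr_gt0 // ltr_wpDl ?mulr_ge0.
set M := point_of_bary A B C _ _ _.
have hM : t * cross h (M - O) =
   a * (s - a) * cross h (A - O) + b * (s - b) * cross h (B - O)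
   + c * (s - c) * cross h (C - O).
  rewrite -!crossZr -!crossDr; congr cross.
  rewrite /M /point_of_bary -/t scalerBr scalerA divff // scale1r /t.
  by apply/rowP => j; rewrite !mxE; ring.
move: (cross h (A - O)) (cross h (B - O)) (cross h (C - O)) hh hI hM circ.
move: (cross h (I - O)) (cross h (M - O)) => hI hM hA hB hC hh
  hIE hME circ.
(* This factor lets [t] and a + b + c absorb the denominators of M and I, and lets R and r be
   eliminated in favour of a, b, c. *)
apply: (mulfI (lt0r_neq0 (mulr_gt0 (mulr_gt0 r_gt0 x_gt0) x_gt0))).
have -> : r * (a + b + c) * (a + b + c) * ((4 * R + r) * hM) =
    (a + b + c) ^+ 2 / 2 * (t * hM).
  by rewrite tE; field.
rewrite hME.
have -> : r * (a + b + c) * (a + b + c) * - ((2 * R + r) * hI) =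
  - ((2 * R * r * (a + b + c) + r ^+ 2 * (a + b + c)) * ((a + b + c) * hI)) by ring.
rewrite hIE -abc.
have -> : r ^+ 2 * (a + b + c) =
    (b + c - a) * (c + a - b) * (a + b - c) / 4.
  have e2x := congr1 (fun y => (a + b + c) * y) e2; rewrite /= in e2x; lra.
(* The difference of the two sides is half of [circ] plus abc(a + b + c) times the zero sum hA + hB
   + hC. *)
have hCE : hC = - hA - hB by lra.
move: circ; rewrite hCE /s => circ; lra.
Qed.

(** * Euler-type formulas and the perfect square *)

Lemma dot_incenter (K : realType) (A B C O I : 'rV[K]_2) (R r : K) :
  nondegenerate_triangle A B C -> is_circumcircle A B C O R ->
  is_incircle A B C I r ->
  let h := (A - O) + (B - O) + (C - O) in
  let s := semiperimeter A B C in
  [/\ dot (I - O) (I - O) = R ^+ 2 - 2 * R * r,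
      dot h h = 9 * R ^+ 2 + 8 * R * r + 2 * r ^+ 2 - 2 * s ^+ 2
    & 2 * dot h (I - O) = 6 * R ^+ 2 + 2 * R * r - r ^+ 2 - s ^+ 2].
Proof.
move=> nd cO inI h s.
have [a_gt0 b_gt0 c_gt0] := sides_gt0 nd.
have [abc e2] := side_symmetric_functions nd cO inI.
have [_ IE] := incircleE nd inI.
have [] := circumcircle_dot cO.
rewrite /h /s /semiperimeter.
move: (dist B C) (dist C A) (dist A B) a_gt0 b_gt0 c_gt0 abc e2 IE.
move=> a b c a_gt0 b_gt0 c_gt0 abc e2 IE.
have x_gt0 : 0 < a + b + c by rewrite !addr_gt0.
have : (a + b + c) *: (I - O) = a *: (A - O) + b *: (B - O) + c *: (C - O).
  by rewrite scalerBr IE; apply/rowP => j; rewrite !mxE; ring.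
move: (A - O) (B - O) (C - O) (I - O) => p q w i iE pp qq ww [qw wp pq].
have x0 := lt0r_neq0 x_gt0.
split.
- apply: (mulfI x0); apply: (mulfI x0); rewrite -dotZr -dotZl iE.
  rewrite !(dotDl, dotDr, dotZl, dotZr) (dotC q p) (dotC w q) (dotC p w).
  rewrite pp qq ww qw wp pq.
  transitivity ((a + b + c) * ((a + b + c) * R ^+ 2 - a * b * c)).
    by field.
  by rewrite abc; ring.
- rewrite !(dotDl, dotDr) (dotC q p) (dotC w q) (dotC p w).
  rewrite pp qq ww qw wp pq; lra.
apply: (mulfI x0); rewrite mulrCA -dotZr iE.
rewrite !(dotDl, dotDr, dotZl, dotZr) (dotC q p) (dotC w q) (dotC p w).
rewrite pp qq ww qw wp pq.
(* The sum of the a(b^2 + c^2) is (a + b + c)(ab + bc + ca) - 3abc. *)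
have e2x := congr1 (fun y => (a + b + c) * y) e2; rewrite /= in e2x.
lra.
Qed.

(** As a quadratic in [s2], the left side has leading coefficient 4R(2R - r) + (2R + r)^2 / 4 = (3R
    - r/2)^2 and zero discriminant. *)
Lemma incenter_gap_square (K : realType) (R r s2 hh ii hi : K) :
  ii = R ^+ 2 - 2 * R * r ->
  hh = 9 * R ^+ 2 + 8 * R * r + 2 * r ^+ 2 - 2 * s2 ->
  2 * hi = 6 * R ^+ 2 + 2 * R * r - r ^+ 2 - s2 ->
  (R ^+ 2 * (4 * R + r) ^+ 2 - 2 * R * (2 * R - r) * s2) * hh
    - (2 * R + r) ^+ 2 * (hh * ii - hi ^+ 2) =
  ((3 * R - r / 2) * s2
     - (12 * R ^+ 3 + 11 * R ^+ 2 * r + 4 * R * r ^+ 2 + r ^+ 3 / 2)) ^+ 2.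
Proof.
move=> -> -> hiE.
have -> : hi = (6 * R ^+ 2 + 2 * R * r - r ^+ 2 - s2) / 2 by lra.
by field.
Qed.

Theorem mainTheorem3 (K : realType) (A B C O H I : 'rV[K]_2) (R r d_I : K)
    (ABC_nondegenerate : nondegenerate_triangle A B C)
    (ABC_non_equilateral : ~ equilateral_triangle A B C)
    (O_circumcenter : is_circumcircle A B C O R)
    (H_orthocenter : is_orthocenter A B C H)
    (I_incenter : is_incircle A B C I r)
    (d_I_def : is_sqdist_to_line I H O d_I) :
  let s := semiperimeter A B C in
  let S := area A B C in
  let M := mittenpunkt A B C in
  R * (4 * R + r) ^+ 2 / (2 * (2 * R - r)) - s ^+ 2 >=
    (4 * R + r) ^+ 2 / (2 * R * (2 * R - r)) *
      (4 * S ^+ 2 * bary_det A B C O H M ^+ 2 / dist O H ^+ 2)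
  /\
  (4 * R + r) ^+ 2 / (2 * R * (2 * R - r)) *
      (4 * S ^+ 2 * bary_det A B C O H M ^+ 2 / dist O H ^+ 2) =
    (2 * R + r) ^+ 2 * d_I / (2 * R * (2 * R - r)).
Proof.
move=> s S M.
have nd := ABC_nondegenerate; have cO := O_circumcenter.
have inI := I_incenter.
have [a_gt0 b_gt0 c_gt0] := sides_gt0 nd.
have [abc _] := side_symmetric_functions nd cO inI.
have r_gt0 : 0 < r by have [] := inI.
have R_gt0 : 0 < R.
  have : 0 < 2 * R * r * (dist B C + dist C A + dist A B).
    by rewrite -abc !mulr_gt0.
  by rewrite pmulr_lgt0 ?addr_gt0 // pmulr_lgt0 // pmulr_rgt0.
have hE := orthocenterE nd cO H_orthocenter.
have := cross_mittenpunkt nd cO inI; have := dot_incenter nd cO inI.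
rewrite /= -hE -/s -/M => -[iiE hhE hiE] hME.
(* Euler's inequality R >= 2r, from OI^2 = R(R - 2r) >= 0. *)
have Rr : 0 < 2 * R - r.
  have := dotvv_ge0 (I - O); rewrite iiE.
  by rewrite (_ : _ - _ = R * (R - 2 * r)) ?pmulr_rge0 //; [lra | ring].
have hh_gt0 : 0 < dot (H - O) (H - O).
  rewrite lt0r dotvv_eq0 dotvv_ge0 andbT.
  apply/eqP; rewrite hE => h0; apply: ABC_non_equilateral.
  exact: (equilateral_of_circumcenter cO h0).
have OH : dist O H ^+ 2 = dot (H - O) (H - O).
  by rewrite sqr_distE !dotE !mxE; ring.
have dE : d_I * dot (H - O) (H - O) = cross (H - O) (I - O) ^+ 2.
  have := sqdist_to_lineE d_I_def.
  by rewrite (_ : dot (O - H) _ = dot (H - O) (H - O)) => [->|];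
    rewrite /cross ?dotE !mxE; ring.
have SE : 4 * S ^+ 2 * bary_det A B C O H M ^+ 2 = cross (H - O) (M - O) ^+ 2.
  rewrite -(bary_detE _ _ _ nd) /S areaE expr_div_n real_normK ?num_real //.
  by field.
have eqI : (4 * R + r) ^+ 2 / (2 * R * (2 * R - r)) *
      (4 * S ^+ 2 * bary_det A B C O H M ^+ 2 / dist O H ^+ 2) =
    (2 * R + r) ^+ 2 * d_I / (2 * R * (2 * R - r)).
  have hM2 : (4 * R + r) ^+ 2 * cross (H - O) (M - O) ^+ 2 =
      (2 * R + r) ^+ 2 * (d_I * dot (H - O) (H - O)).
    by rewrite dE -!exprMn hME sqrrN.
  by rewrite SE OH mulrAC mulrA hM2 mulrA mulfK ?gt_eqF.
split=> //; rewrite eqI -subr_ge0.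
have den_gt0 : 0 < 2 * R * (2 * R - r) by rewrite !mulr_gt0.
have -> : R * (4 * R + r) ^+ 2 / (2 * (2 * R - r)) - s ^+ 2
    - (2 * R + r) ^+ 2 * d_I / (2 * R * (2 * R - r)) =
  (R ^+ 2 * (4 * R + r) ^+ 2 - 2 * R * (2 * R - r) * s ^+ 2
     - (2 * R + r) ^+ 2 * d_I) / (2 * R * (2 * R - r)).
  by field; rewrite !gt_eqF.
apply: divr_ge0; last exact: ltW.
(* Multiplying by |OH|^2 turns [d_I] into a squared cross product, which Lagrange's identity
   expresses by dot products. *)
rewrite -(pmulr_lge0 _ hh_gt0) mulrBl -[_ * d_I * _]mulrA dE cross_sqr.
by rewrite (incenter_gap_square iiE hhE hiE) sqr_ge0.
Qed.
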